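(* For every $n\ge 10$, Breaker cannot win the triangle game $\mathcal{F}_{K_3}(E_b,n)$ even with the maximal matching bias $b=\lfloor n/2\rfloor$; that is, Maker has a winning strategy (with Breaker moving first).
   Context: $\mathcal{F}_{K_3}(E_b,n)$ is the following game on the edge set of $K_n$: players alternate; on each turn Maker claims one unclaimed edge, and Breaker claims a set of at most $b$ pairwise vertex-disjoint unclaimed edges (a subgraph of a matching of size $b$). The game ends when no unclaimed edges remain. Maker wins if her graph contains a triangle; otherwise Breaker wins. *)

(* Defs.v *)
From mathcomp Require Import all_boot.

Set Implicit Arguments.
Unset Strict Implicit.
Unset Printing Implicit Defensive.

Definition edges (n : nat) : {set {set 'I_n}} := [set e : {set 'I_n} | #|e| == 2].

(* A history lists the moves made so far, oldest first; a move is the set of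
   edges claimed on that turn.  Breaker moves first, so the moves at even
   positions are Breaker's and those at odd positions are Maker's. *)
Definition history (n : nat) := seq {set {set 'I_n}}.

Definition breaker_turn (n : nat) (h : history n) : bool := ~~ odd (size h).

Definition maker_turn (n : nat) (h : history n) : bool := odd (size h).

Definition unclaimed (n : nat) (h : history n) : {set {set 'I_n}} :=
  edges n :\: \bigcup_(S <- h) S.

Definition maker_graph (n : nat) (h : history n) : {set {set 'I_n}} :=
  \bigcup_(i < size h | odd i) nth set0 h i.

Definition game_over (n : nat) (h : history n) : bool := unclaimed h == set0.

(* trivIset S: distinct edges of S share no vertex.  The empty move is legal. *)
Definition breaker_legal (n b : nat) (h : history n) (S : {set {set 'I_n}}) :
    bool :=
  [&& S \subset unclaimed h, trivIset S & #|S| <= b].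

Definition has_triangle (n : nat) (G : {set {set 'I_n}}) : Prop :=
  exists x y z : 'I_n,
    [/\ x != y, y != z & x != z] /\
    [/\ [set x; y] \in G, [set y; z] \in G & [set x; z] \in G].

Definition maker_strategy (n : nat) := history n -> {set 'I_n}.

(* The histories, complete or not, that can arise when Maker plays sigma
   against a Breaker who plays arbitrary legal moves. *)
Inductive consistent (n b : nat) (sigma : maker_strategy n) :
    history n -> Prop :=
| consistent_start : consistent b sigma [::]
| consistent_breaker (h : history n) (S : {set {set 'I_n}}) :
    consistent b sigma h -> ~~ game_over h -> breaker_turn h ->
    breaker_legal b h S -> consistent b sigma (rcons h S)
| consistent_maker (h : history n) :
    consistent b sigma h -> ~~ game_over h -> maker_turn h ->
    consistent b sigma (rcons h [set sigma h]).

(* The first clause makes sigma prescribe legal moves; since then each of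
   Maker's turns claims a new edge, every play ends. *)
Definition maker_winning_strategy (n b : nat) (sigma : maker_strategy n) :
    Prop :=
  (forall h : history n, consistent b sigma h -> ~~ game_over h ->
     maker_turn h -> sigma h \in unclaimed h) /\
  (forall h : history n, consistent b sigma h -> game_over h ->
     has_triangle (maker_graph h)).

Definition maker_wins_triangle_game (n b : nat) : Prop :=
  exists sigma : maker_strategy n, maker_winning_strategy b sigma.

(* Main.v *)
Require Import Defs.
From mathcomp Require Import all_boot.
From mathcomp Require Import zify.

Set Implicit Arguments.
Unset Strict Implicit.
Unset Printing Implicit Defensive.

(** Maker builds a star at a vertex [v] with leaves [a], [b], [c].  A matching
contains at most one edge at any vertex, so when [ac] and [bc] are both free at
the moment [vc] is claimed, Breaker cannot take both and Maker closes a
triangle.  To make sure that such a [c] exists, let [X] be the set of Breaker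
neighbours of [v] and [a] after Breaker's second move, when all Breaker degrees
are at most 2.  If some [b] outside [X] and distinct from [v], [a] has
[#|X :|: N(b)| <= 5], then Breaker has to spend his edge at [a] and at [b] on
[ab], and at most [3 + 5 + 1 < 10] vertices are excluded for [c].  Otherwise
[#|X| = 4] and no Breaker edge leaves [X] except towards [v] and [a]; then any
[b] in [N(a)] has [N(b)] inside [X] and [a], so that at most [6 + 3 < 10]
vertices are excluded. *)

(** * Bounded-depth wins and the strategies they yield *)

Section ForcedWin.

Variable n : nat.
Implicit Types (h : history n) (M U S : {set {set 'I_n}}) (e : {set 'I_n}).

Definition has_triangleb M : bool :=
  [exists x, exists y, exists z,
    [&& x != y, y != z, x != z,
        [set x; y] \in M, [set y; z] \in M & [set x; z] \in M]].

Lemma has_triangleP M : reflect (has_triangle M) (has_triangleb M).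
Proof.
apply: (iffP existsP) => [[x /existsP[y /existsP[z]]]|].
  by case/and5P=> xy yz xz Mxy /andP[Myz Mxz]; exists x, y, z.
move=> [x [y [z [[xy yz xz] [Mxy Myz Mxz]]]]]; exists x.
by apply/existsP; exists y; apply/existsP; exists z; apply/and5P; split=> //;
  apply/andP.
Qed.

Lemma has_trianglebS M M' : M \subset M' -> has_triangleb M -> has_triangleb M'.
Proof.
move=> /subsetP sMM' /has_triangleP[x [y [z [D [Mxy Myz Mxz]]]]].
by apply/has_triangleP; exists x, y, z; split=> //; split; apply: sMM'.
Qed.

(* Maker is to move, with graph [M] and unclaimed edges [U]; Breaker's matchings
   have unrestricted size, so the bias plays no role. *)
Fixpoint forced_win (k : nat) M U : bool :=
  has_triangleb M ||
  (if k is k'.+1 then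
     [exists e in U, forall S : {set {set 'I_n}},
        (S \subset U :\ e) && trivIset S ==>
          forced_win k' (e |: M) ((U :\ e) :\: S)]
   else false).

Lemma has_triangle_forced_win k M U : has_triangleb M -> forced_win k M U.
Proof. by case: k => [|k] /= ->. Qed.

Lemma forced_winS k M U e : e \in U ->
  (forall S, S \subset U :\ e -> trivIset S ->
     forced_win k (e |: M) ((U :\ e) :\: S)) ->
  forced_win k.+1 M U.
Proof.
move=> Ue win; apply/orP; right; apply/existsP; exists e; rewrite Ue.
by apply/forallP=> S; apply/implyP=> /andP[]; apply: win.
Qed.

Lemma forced_win_set0 k M : forced_win k M set0 -> has_triangleb M.
Proof.
by case: k => [|k] /= /orP[] // /existsP[e]; rewrite inE.
Qed.

Lemma unclaimed_rcons h S : unclaimed (rcons h S) = unclaimed h :\: S.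
Proof. by rewrite /unclaimed -cats1 big_cat big_seq1 setDDl. Qed.

Lemma maker_graph_rcons h S :
  maker_graph (rcons h S) =
  if odd (size h) then S :|: maker_graph h else maker_graph h.
Proof.
rewrite /maker_graph size_rcons big_mkcond big_ord_recr -big_mkcond /=.
rewrite nth_rcons ltnn eqxx.
rewrite (eq_bigr (fun i : 'I_(size h) => nth set0 h i)); last first.
  by move=> i _; rewrite nth_rcons ltn_ord.
by case: ifP => _; rewrite ?setU0 // setUC.
Qed.

(** On Maker's turn [(size h)./2] is the number of moves she has made, so [K - (size h)./2] counts
    the rounds left; the subtraction stops at 0, where [forced_win] means that the triangle is
    already there. The default, an arbitrary free edge, keeps the strategy legal from then on. *)
Definition forced_strategy (K : nat) : maker_strategy n := fun h =>
  let U := unclaimed h in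
  odflt (odflt set0 [pick e in U])
    [pick e in U | [forall S : {set {set 'I_n}},
       (S \subset U :\ e) && trivIset S ==>
         forced_win (K - (size h)./2).-1 (e |: maker_graph h) ((U :\ e) :\: S)]].

(** When no edge passes the strategy's test, [forced_win] can only hold because a triangle is
    present; triangles survive further moves, so any free edge serves. *)
Lemma forced_strategyP K h (U := unclaimed h) (e := forced_strategy K h) :
  U != set0 -> forced_win (K - (size h)./2) (maker_graph h) U ->
  e \in U /\ forall S, S \subset U :\ e -> trivIset S ->
    forced_win (K - (size h)./2).-1 (e |: maker_graph h) ((U :\ e) :\: S).
Proof.
rewrite {}/e /forced_strategy -/U => Un0 win.
have : odflt set0 [pick e in U] \in U.
  by case: pickP => [//|noU]; case/set0Pn: Un0 => e; rewrite noU.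
move: (odflt set0 _) => e0 Ue0.
case: pickP => [e /andP[Ue /forallP winS] | no_e] /=.
  by split=> // S sS tS; apply: (implyP (winS S)); rewrite sS.
have tri : has_triangleb (maker_graph h).
  move: win no_e; case: (K - _) => [|k] /= /orP[] //.
  by case/existsP=> e win /(_ e); rewrite /= win.
split=> // S _ _.
by apply/has_triangle_forced_win/(has_trianglebS _ tri)/subsetUr.
Qed.

Lemma maker_wins_of_forced_win K b :
  (forall S, S \subset edges n -> trivIset S ->
     forced_win K set0 (edges n :\: S)) ->
  maker_wins_triangle_game n b.
Proof.
move=> win; exists (forced_strategy K).
(* Since [forced_win] speaks of positions with Maker to move, the invariant looks one matching ahead
   on Breaker's turn. *)
pose inv h : Prop := if odd (size h) then
    forced_win (K - (size h)./2) (maker_graph h) (unclaimed h) : Prop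
  else forall S, S \subset unclaimed h -> trivIset S ->
    forced_win (K - (size h)./2) (maker_graph h) (unclaimed h :\: S).
have invP h : consistent b (forced_strategy K) h -> inv h.
  elim=> {h} [S|h S _ IH _ hB /and3P[sS tS _]|h _ IH hU hM].
  - rewrite /unclaimed big_nil setD0 subn0 /maker_graph big_ord0.
    exact: win.
  - move: IH; rewrite /inv unclaimed_rcons maker_graph_rcons size_rcons /=.
    move: hB; rewrite /breaker_turn uphalf_half => /negPf -> /=.
    by apply.
  - move: IH; rewrite /inv unclaimed_rcons maker_graph_rcons size_rcons /=.
    move: hM; rewrite /maker_turn uphalf_half => -> /= IH.
    have [_ win'] := forced_strategyP hU IH.
    by rewrite add1n subnS.
split=> h cons_h.
  move=> hU hM; have := invP h cons_h; rewrite /inv [odd _]hM => IH.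
  by have [] := forced_strategyP hU IH.
move=> /eqP U0; have := invP h cons_h; rewrite /inv U0.
case: (odd _) => [/forced_win_set0/has_triangleP //|].
(* If the board is full on Breaker's turn, the invariant is applied to the empty matching. *)
have triv0 : trivIset (set0 : {set {set 'I_n}}).
  by apply/trivIsetP=> A B; rewrite inE.
move=> /(_ set0 (sub0set _) triv0); rewrite setD0.
by move=> /forced_win_set0/has_triangleP.
Qed.

End ForcedWin.

(** * Breaker's degrees and Maker's star *)

Section TriangleGame.

Variable n : nat.
Implicit Types (M U S : {set {set 'I_n}}) (x y z v a b c : 'I_n).

Lemma cardsU_leq (A B : {set 'I_n}) : #|A :|: B| <= #|A| + #|B|.
Proof. by rewrite cardsU leq_subr. Qed.

Lemma exists_notin (A : {set 'I_n}) : #|A| < n -> exists x, x \notin A.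
Proof.
move=> ltAn; have /card_gt0P[x] : 0 < #|~: A|.
  by rewrite cardsCs setCK card_ord subn_gt0.
by rewrite inE; exists x.
Qed.

Definition nbrs S x : {set 'I_n} := [set y | [set x; y] \in S].

Lemma edgesE x y : ([set x; y] \in edges n) = (x != y).
Proof. by rewrite inE cards2; case: (x != y). Qed.

Lemma set2_inj x y z : [set x; y] = [set x; z] -> y = z.
Proof.
move=> E; have := set22 x y; rewrite E !inE => /orP[]/eqP // yx.
by have := set22 x z; rewrite -E !inE yx orbb => /eqP ->.
Qed.

Lemma nbrsC S x y : (x \in nbrs S y) = (y \in nbrs S x).
Proof. by rewrite !inE setUC. Qed.

Lemma nbrsU S S' x : nbrs (S :|: S') x = nbrs S x :|: nbrs S' x.
Proof. by apply/setP=> y; rewrite !inE. Qed.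

Lemma matching_inj S x y z : trivIset S ->
  [set x; y] \in S -> [set x; z] \in S -> y = z.
Proof.
move=> /trivIsetP tS Sxy Sxz; apply: (@set2_inj x); apply/eqP.
apply: contraT => ne; have := tS _ _ Sxy Sxz ne.
by move=> /pred0P/(_ x) /=; rewrite !set21.
Qed.

Lemma card_nbrs_matching S x : trivIset S -> #|nbrs S x| <= 1.
Proof.
move=> tS; apply/card_le1_eqP => y z; rewrite !inE => Sy Sz.
exact: matching_inj tS Sz Sy.
Qed.

Lemma forced_win_close k M U x y z : x != y -> y != z -> x != z ->
  [set x; y] \in M -> [set x; z] \in M -> [set y; z] \in U ->
  forced_win k.+1 M U.
Proof.
move=> xy yz xz Mxy Mxz Uyz; apply: (forced_winS Uyz) => S _ _.
apply/has_triangle_forced_win/has_triangleP; exists x, y, z; split=> //.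
by rewrite !inE Mxy Mxz eqxx !orbT.
Qed.

Lemma forced_win_double_threat k M U v a b c :
  uniq [:: v; a; b; c] -> [set v; a] \in M -> [set v; b] \in M ->
  [set v; c] \in U -> [set a; c] \in U -> [set b; c] \in U ->
  forced_win k.+2 M U.
Proof.
move=> /and4P[]; rewrite !inE !negb_or => /and3P[va vb vc] /andP[ab ac] bc _.
move=> Mva Mvb Uvc Uac Ubc; apply: (forced_winS Uvc) => S _ tS.
have nac : [set a; c] != [set v; c].
  by rewrite setUC [X in _ != X]setUC; apply: contraNneq va => /set2_inj ->.
have nbc : [set b; c] != [set v; c].
  by rewrite setUC [X in _ != X]setUC; apply: contraNneq vb => /set2_inj ->.
have [Sac|Sac] := boolP ([set a; c] \in S); last first.
  by apply: (@forced_win_close _ _ _ v a c) => //; rewrite !inE ?Mva ?eqxx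
    ?orbT // Sac nac Uac.
have Sbc : [set b; c] \notin S.
  apply: contra ab => Sbc; apply/eqP.
  by apply: (@matching_inj S c) => //; rewrite setUC.
by apply: (@forced_win_close _ _ _ v b c) => //; rewrite !inE ?Mvb ?eqxx
  ?orbT // Sbc nbc Ubc.
Qed.

(* Breaker's next matching can add three excluded vertices to [Z], but only one,
   at [v], if it has to contain the free edge [ab]; hence the bounds 6 and 8. *)
Lemma second_leaf S v a : 10 <= n -> (forall x, #|nbrs S x| <= 2) ->
  (forall x, x \notin nbrs S x) -> v != a -> a \notin nbrs S v ->
  exists b (Z : {set 'I_n} := [set v; a; b] :|: (nbrs S v :|: nbrs S a :|: nbrs S b)),
    [/\ b != v, b != a, b \notin nbrs S v &
        (b \notin nbrs S a) && (#|Z| <= 8) || (#|Z| <= 6)].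
Proof.
move=> n10 deg irr va Sva; set X := nbrs S v :|: nbrs S a.
have cX : #|X| <= 4.
  by apply: leq_trans (cardsU_leq _ _) _; apply: (leq_add (deg v) (deg a)).
have c3 b : #|[set v; a; b]| <= 3.
  by rewrite setUC cardsU1 cards2; case: (_ \notin _); case: (_ != _).
have [/existsP[b /andP[bvaX cb]]|noY] :=
  boolP [exists b, (b \notin [set v; a] :|: X) && (#|X :|: nbrs S b| <= 5)].
  move: bvaX; rewrite !in_setU !in_set1 !negb_or.
  move=> /andP[/andP[bv ba] /andP[bv' ba']].
  exists b; split=> //; apply/orP; left; rewrite ba' /=.
  by apply: leq_trans (cardsU_leq _ _) _; apply: leq_add (c3 b) cb.
have farY y : y \notin [set v; a] :|: X -> 6 <= #|X :|: nbrs S y|.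
  move=> Yy; rewrite ltnNge; apply: contra noY => cy.
  by apply/existsP; exists y; rewrite Yy.
have [y Yy] : exists y, y \notin [set v; a] :|: X.
  apply: exists_notin; apply: leq_ltn_trans (cardsU_leq _ _) _.
  rewrite cards2 va; apply: leq_trans n10; rewrite ltnS.
  exact: leq_trans (leq_add (leqnn 2) cX) _.
(* The vertex [y] gives [6 <= #|X| + 2]. Equality in [#|X| <= 2 + 2] then makes the two
   neighbourhoods disjoint and [nbrs S a] nonempty. *)
have {}cX : #|X| = 4.
  have := farY y Yy; have := deg y; have := cardsU_leq X (nbrs S y); lia.
have dis : nbrs S v :&: nbrs S a = set0.
  apply/eqP; rewrite -cards_eq0; have := cardsUI (nbrs S v) (nbrs S a).
  by rewrite -/X cX; have := deg v; have := deg a; lia.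
have [b ab] : exists b, b \in nbrs S a.
  suff : 0 < #|nbrs S a| by case/card_gt0P=> b; exists b.
  by have := cardsU_leq (nbrs S v) (nbrs S a); rewrite -/X cX; have := deg v; lia.
have vb : b \notin nbrs S v.
  by apply/negP=> vb; move/setP/(_ b): dis; rewrite in_set0 in_setI vb ab.
have bv : b != v by apply: contraNneq Sva => E; rewrite nbrsC -E.
have ba : b != a by apply: contraTneq ab => ->.
have Xb : b \in X by rewrite in_setU ab orbT.
exists b; split=> //; apply/orP; right.
(* A neighbour [z] of [b] outside this set would have [b] in both [X] and [nbrs S z], so their union
   would have at most 4 + 2 - 1 = 5 elements, against [farY]. *)
have sb : nbrs S b \subset [set v; a] :|: X.
  apply/subsetP=> z bz; apply: contraT => Yz.
  suff : #|X :|: nbrs S z| < 6 by rewrite ltnNge farY.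
  apply: leq_trans (leq_add (leqnn 4) (deg z)).
  rewrite -cX -cardsUI -[ltnLHS]addn0 ltn_add2l; apply/card_gt0P; exists b.
  by rewrite in_setI Xb nbrsC.
(* As [b] lies in [X], the whole of [Z] lies in this set of 2 + 4 vertices. *)
apply: (@leq_trans #|[set v; a] :|: X|).
  apply/subset_leq_card/subUsetP; split; first by rewrite setUS // sub1set.
  by apply/subUsetP; split; first exact: subsetUr.
by apply: leq_trans (cardsU_leq _ _) _; rewrite cX cards2 va.
Qed.

(** Four Maker moves suffice: [va], [vb], [vc] and a closing edge [ac] or [bc]; or only three if
    [ab] is still free after [vb]. *)
Lemma breaker_moves_first S1 : 10 <= n -> S1 \subset edges n -> trivIset S1 ->
  forced_win 4 set0 (edges n :\: S1).
Proof.
move=> n10 sS1 tS1.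
have n_gt0 : 0 < n by apply: leq_trans n10.
pose v : 'I_n := Ordinal n_gt0.
have [a] : exists a, a \notin v |: nbrs S1 v.
  apply: exists_notin; apply: leq_ltn_trans (cardsU_leq _ _) _.
  rewrite cards1; apply: leq_trans n10; rewrite ltnS.
  exact: leq_trans (leq_add (leqnn 1) (card_nbrs_matching v tS1)) _.
rewrite !inE negb_or => /andP[av S1va].
have va : v != a by rewrite eq_sym.
have Uva : [set v; a] \in edges n :\: S1 by rewrite in_setD edgesE va S1va.
apply: (forced_winS Uva) => S2 sS2 tS2.
have S2va : [set v; a] \notin S2.
  by apply/negP=> /(subsetP sS2); rewrite !inE eqxx.
set S := S1 :|: S2.
have sS : S \subset edges n.
  rewrite subUset sS1; apply: subset_trans sS2 _.
  by apply: subset_trans (subD1set _ _) (subsetDl _ _).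
have degS x : #|nbrs S x| <= 2.
  rewrite nbrsU; apply: leq_trans (cardsU_leq _ _) _.
  exact: leq_add (card_nbrs_matching x tS1) (card_nbrs_matching x tS2).
have irrS x : x \notin nbrs S x.
  by rewrite in_set; apply/negP=> /(subsetP sS); rewrite edgesE eqxx.
have Sva : a \notin nbrs S v by rewrite in_set in_setU negb_or S1va.
have [b [bv ba Svb cZ]] := second_leaf n10 degS irrS va Sva.
set Z := [set v; a; b] :|: (nbrs S v :|: nbrs S a :|: nbrs S b) in cZ.
set M1 := _ |: set0; set U2 := _ :\: S2.
have U2P x y : x != y -> y \notin nbrs S x -> [set x; y] != [set v; a] ->
    [set x; y] \in U2.
  move=> xy; rewrite in_set in_setU negb_or => /andP[S1xy S2xy] ne.
  by rewrite !in_setD in_set1 edgesE xy S1xy S2xy ne.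
have set2_neq x y z : y != z -> [set x; y] != [set x; z].
  by apply: contraNneq => /set2_inj ->.
have Uvb : [set v; b] \in U2.
  by apply: U2P => //; [rewrite eq_sym | apply: set2_neq].
have M1va : [set v; a] \in M1 by apply: setU11.
apply: (forced_winS Uvb) => S3 _ tS3; set M2 := _ |: M1; set U3 := _ :\: S3.
have M2vb : [set v; b] \in M2 by apply: setU11.
have M2va : [set v; a] \in M2 by apply: setU1r.
have nbr_v x y z : y != v -> z != v -> [set y; z] != [set v; x].
  move=> yv zv; apply/eqP=> E; have := set21 v x.
  by rewrite -E !inE !(eq_sym v) (negPf yv) (negPf zv).
have [S3ab|S3ab] := boolP ((b \notin nbrs S a) && ([set a; b] \notin S3)).
  case/andP: S3ab => Sab S3ab.
  apply: (@forced_win_close _ _ _ v a b) => //; try by rewrite eq_sym.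
  rewrite 2!in_setD in_set1 S3ab nbr_v //=.
  by apply: U2P => //; [rewrite eq_sym | apply: nbr_v].
set N3 := nbrs S3 v :|: nbrs S3 a :|: nbrs S3 b.
(* At most 9 vertices are excluded: 6 + 3 when [Z] is small, otherwise 8 + 1. *)
have [c] : exists c, c \notin Z :|: N3.
  apply: exists_notin; apply: leq_trans n10; rewrite ltnS.
  have d3 x := card_nbrs_matching x tS3.
  case/orP: cZ => [/andP[Sab cZ]|cZ]; last first.
    apply: leq_trans (cardsU_leq _ _) _; apply: (leq_add cZ).
    apply: leq_trans (cardsU_leq _ _) _; apply: (@leq_add _ _ 2 1) (d3 b).
    by apply: leq_trans (cardsU_leq _ _) _; apply: leq_add (d3 v) (d3 a).
  (* Here [S3] contains [ab], its only edge at [a] and at [b]; both ends are in [Z] already, so only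
     the [S3]-neighbour of [v] can be new. *)
  move: S3ab; rewrite Sab negbK => S3ab.
  apply: (@leq_trans #|Z :|: nbrs S3 v|); last first.
    by apply: leq_trans (cardsU_leq _ _) _; apply: leq_add cZ (d3 v).
  apply: subset_leq_card; rewrite subUset subsetUl /N3 !subUset subsetUr /=.
  apply/andP; split; apply/subsetP=> z; rewrite in_set => S3z.
    rewrite (matching_inj tS3 S3z S3ab).
    by rewrite /Z !in_setU !in_set1 eqxx !orbT.
  have S3ba : [set b; a] \in S3 by rewrite setUC.
  rewrite (matching_inj tS3 S3z S3ba).
  by rewrite /Z !in_setU !in_set1 eqxx !orbT.
rewrite /Z /N3 !in_setU !in_set1 !negb_or -!andbA.
case/and5P=> cv ca cb Svc /and5P[Sac Sbc S3vc S3ac S3bc].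
rewrite !in_set in S3vc S3ac S3bc.
have U3P x : x != c -> c \notin nbrs S x -> [set x; c] \notin S3 ->
    [set x; c] != [set v; a] -> [set x; c] != [set v; b] -> [set x; c] \in U3.
  move=> xc Sxc S3xc ne1 ne2.
  by rewrite 2!in_setD in_set1 S3xc ne2 /=; apply: U2P.
apply: (@forced_win_double_threat _ _ _ v a b c) => //.
- rewrite /= !inE !negb_or va (eq_sym v b) bv (eq_sym v c) cv.
  by rewrite (eq_sym a b) ba (eq_sym a c) ca (eq_sym b c) cb.
- by apply: U3P => //; first [by rewrite eq_sym | exact: set2_neq].
- by apply: U3P => //; first [by rewrite eq_sym | exact: nbr_v].
- by apply: U3P => //; first [by rewrite eq_sym | exact: nbr_v].
Qed.

End TriangleGame.

Theorem theorem4p1 (n : nat) (hn : 10 <= n) :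
  maker_wins_triangle_game n n./2.
Proof.
apply: (@maker_wins_of_forced_win n 4) => S.
exact: breaker_moves_first.
Qed.
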